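(* Let $\pi^*$ be a self-inverting permutation of $\{1,\ldots,n\}$. The reducible permutation flow-graph $F[\pi^*]$ (defined in the context) can be constructed from $\pi^*$ by the algorithm Encode\_SIP-to-RPG in $O(n)$ time and $O(n)$ space.
   Context: A permutation $\pi$ of $\{1,\ldots,n\}$ is self-inverting if $\pi_{\pi_i}=i$ for all $i$. Write $\pi^{-1}_i$ for the position of the value $i$ in $\pi$. An element $i$ dominates an element $j$ if $i>j$ and $\pi^{-1}_i<\pi^{-1}_j$; $i$ directly dominates (didominates) $j$ if $i$ dominates $j$ and there is no $k$ such that $i$ dominates $k$ and $k$ dominates $j$. The DAG $D[\pi]$: vertices $v_1,\ldots,v_n$ together with $s=v_{n+1}$ and $t=v_0$; an edge $(v_i,v_j)$ for each pair with $i$ didominating $j$ ($1\le i,j\le n$); then an edge $(s,v_i)$ for every $v_i$ ($1\le i\le n$) with no incoming didomination edge and an edge $(v_i,t)$ for every $v_i$ ($1\le i\le n$) with no outgoing didomination edge. For $1\le i\le n$ let $p(v_i)$ be the in-neighbour of $v_i$ in $D[\pi]$ of maximum index. The flow-graph $F[\pi]$: nodes $u_0=t,u_1,\ldots,u_n,u_{n+1}=s$; ''list pointer'' edges $(u_{i+1},u_i)$ for $0\le i\le n$; and for each $1\le i\le n$ a ''max-didomination pointer'' edge $(u_i,u_m)$ where $v_m=p(v_i)$. The algorithm Encode\_SIP-to-RPG computes $F[\pi^*]$ from $\pi^*$ by building $D[\pi^*]$, computing $p$, and adding these edges.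
   Formalization: The DAG D[π*] built by the algorithm is held implicitly (a table of positions plus marks for the edges at s and t), not as a list of edges: it can have n²/4 edges, e.g. for (m+1,…,2m,1,…,m), so listing them in O(n) is impossible. F[π*] is output explicitly. *)

(* Defs.v *)
From mathcomp Require Import all_boot all_fingroup.

Set Implicit Arguments.
Unset Strict Implicit.
Unset Printing Implicit Defensive.

(* A permutation of {1,...,n} is an element of 'S_n: the ordinal k : 'I_n
   stands for the element (and for the position) k.+1. *)

Definition self_inverting n (pi : 'S_n) : Prop := forall i, pi (pi i) = i.

(* [pos i] is the position of the element i. *)
Definition dominates n (pos : 'I_n -> nat) (i j : 'I_n) : bool :=
  (j < i) && (pos i < pos j).

Definition didominates n (pos : 'I_n -> nat) (i j : 'I_n) : bool :=
  dominates pos i j && ~~ [exists k, dominates pos i k && dominates pos k j].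

Definition position n (pi : 'S_n) (i : 'I_n) : nat := (pi^-1)%g i.

(* Edge relation of a graph on v_0 = t, v_1, ..., v_n, v_{n+1} = s, a vertex
   being given by its index: v_i -> v_j for [inner i j], s -> v_i for
   [from_s i], and v_i -> t for [to_t i]. *)
Definition st_graph n (inner : rel 'I_n) (from_s to_t : pred 'I_n) : rel nat :=
  fun a b =>
  [|| [exists i : 'I_n, exists j : 'I_n,
         [&& a == i.+1, b == j.+1 & inner i j]],
      (a == n.+1) && [exists i : 'I_n, (b == i.+1) && from_s i]
    | (b == 0) && [exists i : 'I_n, (a == i.+1) && to_t i]].

Definition D_edge n (pi : 'S_n) : rel nat :=
  let di := didominates (position pi) in
  st_graph di (fun i => ~~ [exists k, di k i]) (fun i => ~~ [exists k, di i k]).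

(* Index of p(v_{i+1}), the in-neighbour of v_{i+1} of maximum index. *)
Definition max_in n (pi : 'S_n) (i : 'I_n) : nat :=
  \max_(a < n.+2 | D_edge pi a i.+1) a.

Lemma max_in_edge n (pi : 'S_n) (i : 'I_n) : D_edge pi (max_in pi i) i.+1.
Proof.
have [a Da] : {a : 'I_n.+2 | D_edge pi a i.+1}.
  apply: sigW.
  case: (boolP [exists k, didominates (position pi) k i]) => [/existsP[k dk]|nd].
    exists (inord k.+1); rewrite inordK; last by rewrite ltnS ltnW // ltnS ltn_ord.
    apply/or3P; apply: Or31; apply/existsP; exists k; apply/existsP; exists i.
    by rewrite !eqxx.
  exists ord_max; apply/or3P; apply: Or32; rewrite eqxx /=.
  by apply/existsP; exists i; rewrite eqxx.
have ne : 0 < #|[pred a : 'I_n.+2 | D_edge pi a i.+1]|.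
  by apply/card_gt0P; exists a.
have [m Dm maxE] := eq_bigmax_cond (@nat_of_ord n.+2) ne.
have -> : max_in pi i = m by exact: maxE.
exact: Dm.
Qed.

(* Edge relation of F[pi] on u_0 = t, u_1, ..., u_n, u_{n+1} = s: list
   pointers, then max-didomination pointers. *)
Definition F_edge n (pi : 'S_n) : rel nat := fun a b =>
  ((b <= n) && (a == b.+1))
  || [exists i : 'I_n, (a == i.+1) && (b == max_in pi i)].

(* A random access machine under the unit-cost measure.  Registers and memory
   cells hold natural numbers; a program is a finite piece of syntax, so it uses
   a fixed number of registers and constants. *)

Record state := State { reg : nat -> nat; mem : nat -> nat }.

Inductive prog :=
| Const of nat & nat          (* r := k           *)
| Add of nat & nat & nat      (* r := x + y       *)
| Sub of nat & nat & nat      (* r := x - y, truncated *)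
| Read of nat & nat           (* r := mem[x]      *)
| Write of nat & nat          (* mem[x] := y      *)
| Seq of prog & prog
| IfLt of nat & nat & prog & prog
| WhileLt of nat & nat & prog.

Definition upd (f : nat -> nat) (a v : nat) : nat -> nat :=
  fun x => if x == a then v else f x.

Definition set_reg (s : state) r v := State (upd (reg s) r v) (mem s).
Definition set_mem (s : state) a v := State (reg s) (upd (mem s) a v).

(* [run B c s T s']: started in s, the program c halts in s' after T steps, every
   memory access having an address < B and every computed number being < B.
   So c uses B memory cells, each holding a word of log2 B bits; the bound on
   numbers excludes packing unboundedly much data into one cell. *)
Inductive run (B : nat) : prog -> state -> nat -> state -> Prop :=
| RunConst s r k :
    k < B -> run B (Const r k) s 1 (set_reg s r k)
| RunAdd s r x y :
    reg s x + reg s y < B ->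
    run B (Add r x y) s 1 (set_reg s r (reg s x + reg s y))
| RunSub s r x y :
    reg s x - reg s y < B ->
    run B (Sub r x y) s 1 (set_reg s r (reg s x - reg s y))
| RunRead s r x :
    reg s x < B -> mem s (reg s x) < B ->
    run B (Read r x) s 1 (set_reg s r (mem s (reg s x)))
| RunWrite s x y :
    reg s x < B -> reg s y < B ->
    run B (Write x y) s 1 (set_mem s (reg s x) (reg s y))
| RunSeq c1 c2 s s1 s2 T1 T2 :
    run B c1 s T1 s1 -> run B c2 s1 T2 s2 ->
    run B (Seq c1 c2) s (T1 + T2) s2
| RunIfTrue x y c1 c2 s s' T :
    reg s x < reg s y -> run B c1 s T s' -> run B (IfLt x y c1 c2) s T.+1 s'
| RunIfFalse x y c1 c2 s s' T :
    reg s y <= reg s x -> run B c2 s T s' -> run B (IfLt x y c1 c2) s T.+1 s'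
| RunWhileTrue x y c s s1 s2 T1 T2 :
    reg s x < reg s y -> run B c s T1 s1 ->
    run B (WhileLt x y c) s1 T2 s2 ->
    run B (WhileLt x y c) s (T1 + T2).+1 s2
| RunWhileFalse x y c s :
    reg s y <= reg s x -> run B (WhileLt x y c) s 1 s.

(* Input convention: register 0 holds n, cell i holds pi_i for 1 <= i <= n, and
   everything else is 0. *)
Definition input n (pi : 'S_n) : state :=
  State (upd (fun=> 0) 0 n)
        (fun a => if a is k.+1 then
                    if insub k is Some i then (pi (i : 'I_n)).+1 else 0
                  else 0).

(* The entry for element i.+1 of the table whose base address is in register r. *)
Definition entry (s : state) (r : nat) n (i : 'I_n) : nat :=
  mem s (reg s r + i.+1).

(* D[pi] may have quadratically many edges, so its didomination edges are stored
   implicitly, through a table of positions (base in register 1); the edges at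
   s and at t are stored explicitly, through two tables of marks (bases in
   registers 2 and 3). *)
Definition stores_D (s : state) n (pi : 'S_n) : Prop :=
  forall a b,
    st_graph (didominates (entry s 1 (n := n)))
             (fun i => entry s 2 i == 1) (fun i => entry s 3 i == 1) a b
    = D_edge pi a b.

Definition stores_p (s : state) n (pi : 'S_n) : Prop :=
  forall i : 'I_n, entry s 1 i = max_in pi i.

(* Register 1 holds the base address of an array of edges, each one a pair of
   consecutive cells, and register 2 holds the number of edges. *)
Definition edge_array (s : state) : seq (nat * nat) :=
  [seq (mem s (reg s 1 + k.*2), mem s (reg s 1 + k.*2.+1))
  | k <- iota 0 (reg s 2)].

Definition stores_F (s : state) n (pi : 'S_n) : Prop :=
  uniq (edge_array s) /\
  forall a b, ((a, b) \in edge_array s) = F_edge pi a b.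

(* [Encode_SIP_to_RPG build_D compute_p add_edges B T pi]: the three programs,
   run one after the other on input pi, carry out the three steps of the
   algorithm, within T steps in total and within B cells of memory. *)
Definition Encode_SIP_to_RPG (build_D compute_p add_edges : prog) (B T : nat)
    n (pi : 'S_n) : Prop :=
  exists s1 s2 s3 T1 T2 T3,
    [/\ run B build_D (input pi) T1 s1 /\ stores_D s1 pi,
        run B compute_p s1 T2 s2 /\ stores_p s2 pi,
        run B add_edges s2 T3 s3 /\ stores_F s3 pi
      & T1 + T2 + T3 <= T].

(* Main.v *)
(* Since a self-inverting permutation is its own table of positions, the input
   already stores the didomination edges of D[pi]; the edges at s and t come from
   suffix minima and prefix maxima.  The didominators of v_i form an antichain, so
   the one of maximum index is the rightmost dominator, that is, the nearest
   greater element to the left of i in pi.  The classical stack algorithm finds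
   all of these in amortised linear time. *)

From mathcomp Require Import zify.
Require Import Defs.
From mathcomp Require Import all_boot all_fingroup.
Import Defs.

Set Implicit Arguments.
Unset Strict Implicit.
Unset Printing Implicit Defensive.

(** * Time-budgeted rules for running programs *)

(* [t] is a time budget; the postcondition receives the unspent part of it, so
   that loop invariants can carry amortised bounds. *)
Definition wp (B : nat) (c : prog) (t : nat) (s : state)
    (Q : nat -> state -> Prop) : Prop :=
  exists T t' s', [/\ run B c s T s', T + t' <= t & Q t' s'].

Lemma wp_seq B c1 c2 t s Q :
  wp B c1 t s (fun t1 s1 => wp B c2 t1 s1 Q) -> wp B (Seq c1 c2) t s Q.
Proof.
move=> [T1 [t1 [s1 [r1 le1 [T2 [t2 [s2 [r2 le2 q]]]]]]]].
exists (T1 + T2), t2, s2; split=> //; last by lia.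
exact: RunSeq r1 r2.
Qed.

Lemma wp_const B r k t s (Q : nat -> state -> Prop) :
  0 < t -> k < B -> Q t.-1 (set_reg s r k) -> wp B (Const r k) t s Q.
Proof.
move=> t0 kB q; exists 1, t.-1, (set_reg s r k).
by split=> //; [exact: RunConst | lia].
Qed.

Lemma wp_add B r x y t s (Q : nat -> state -> Prop) :
  0 < t -> reg s x + reg s y < B ->
  Q t.-1 (set_reg s r (reg s x + reg s y)) -> wp B (Add r x y) t s Q.
Proof.
move=> t0 vB q; exists 1, t.-1, (set_reg s r (reg s x + reg s y)).
by split=> //; [exact: RunAdd | lia].
Qed.

Lemma wp_sub B r x y t s (Q : nat -> state -> Prop) :
  0 < t -> reg s x - reg s y < B ->
  Q t.-1 (set_reg s r (reg s x - reg s y)) -> wp B (Sub r x y) t s Q.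
Proof.
move=> t0 vB q; exists 1, t.-1, (set_reg s r (reg s x - reg s y)).
by split=> //; [exact: RunSub | lia].
Qed.

Lemma wp_read B r x t s (Q : nat -> state -> Prop) :
  0 < t -> reg s x < B -> mem s (reg s x) < B ->
  Q t.-1 (set_reg s r (mem s (reg s x))) -> wp B (Read r x) t s Q.
Proof.
move=> t0 xB vB q; exists 1, t.-1, (set_reg s r (mem s (reg s x))).
by split=> //; [exact: RunRead | lia].
Qed.

Lemma wp_write B x y t s (Q : nat -> state -> Prop) :
  0 < t -> reg s x < B -> reg s y < B ->
  Q t.-1 (set_mem s (reg s x) (reg s y)) -> wp B (Write x y) t s Q.
Proof.
move=> t0 xB yB q; exists 1, t.-1, (set_mem s (reg s x) (reg s y)).
by split=> //; [exact: RunWrite | lia].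
Qed.

Lemma wp_if B x y c1 c2 t s (Q : nat -> state -> Prop) :
  0 < t ->
  (reg s x < reg s y -> wp B c1 t.-1 s Q) ->
  (reg s y <= reg s x -> wp B c2 t.-1 s Q) ->
  wp B (IfLt x y c1 c2) t s Q.
Proof.
move=> t0 w1 w2; case: (ltnP (reg s x) (reg s y)) => [lt | ge].
  have [T [t' [s' [r le q]]]] := w1 lt.
  by exists T.+1, t', s'; split=> //; [exact: RunIfTrue | lia].
have [T [t' [s' [r le q]]]] := w2 ge.
by exists T.+1, t', s'; split=> //; [exact: RunIfFalse | lia].
Qed.

(** The budget is itself the termination measure: each test costs one unit, so strong induction on
    [t] needs no separate variant. *)
Lemma wp_while B x y c (I Q : nat -> state -> Prop) :
  (forall t s, I t s ->
     0 < t /\ if reg s x < reg s y then wp B c t.-1 s I else Q t.-1 s) ->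
  forall t s, I t s -> wp B (WhileLt x y c) t s Q.
Proof.
move=> step; elim/ltn_ind=> t IH s /step[t0].
case: ltnP => [lt [T1 [t1 [s1 [r1 le1 i1]]]] | ge q].
  have [|T2 [t2 [s2 [r2 le2 q]]]] := IH t1 _ s1 i1; first by lia.
  exists (T1 + T2).+1, t2, s2; split=> //; last by lia.
  exact: RunWhileTrue lt r1 r2.
by exists 1, t.-1, s; split=> //; [exact: RunWhileFalse | lia].
Qed.

Lemma wp_mono B c t s (P Q : nat -> state -> Prop) :
  wp B c t s P -> (forall t' s', P t' s' -> Q t' s') -> wp B c t s Q.
Proof.
by move=> [T [t' [s' [r le p]]]] PQ; exists T, t', s'; split=> //; exact: PQ.
Qed.

(** * Domination and the pointers [p] *)

Lemma exists_ltS n k (kn : k < n) (P : pred 'I_n) :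
  [exists j : 'I_n, (j < k.+1) && P j] =
  [exists j : 'I_n, (j < k) && P j] || P (Ordinal kn).
Proof.
apply/existsP/orP => [[j /andP[jk Pj]] | [/existsP[j /andP[jk Pj]] | Pk]].
- case: (ltnP j k) => [lt|ge]; first by left; apply/existsP; exists j; rewrite lt.
  by right; rewrite (_ : Ordinal kn = j) //; apply: val_inj => /=; lia.
- by exists j; rewrite Pj ltnW.
- by exists (Ordinal kn); rewrite /= ltnSn.
Qed.

Lemma exists_leS n k (kn : k < n) (P : pred 'I_n) :
  [exists j : 'I_n, (k <= j) && P j] =
  [exists j : 'I_n, (k < j) && P j] || P (Ordinal kn).
Proof.
apply/existsP/orP => [[j /andP[jk Pj]] | [/existsP[j /andP[jk Pj]] | Pk]].
- case: (ltnP k j) => [lt|ge]; first by left; apply/existsP; exists j; rewrite lt.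
  by right; rewrite (_ : Ordinal kn = j) //; apply: val_inj => /=; lia.
- by exists j; rewrite Pj ltnW.
- by exists (Ordinal kn); rewrite /= leqnn.
Qed.

(** Only the order of positions matters, so a table counting from 1 can replace [position], which
    counts from 0. *)
Lemma didominates_ltn_mono n (p q : 'I_n -> nat) :
  (forall i j, (p i < p j) = (q i < q j)) -> didominates p =2 didominates q.
Proof.
move=> pq i j; rewrite /didominates /dominates pq.
by congr (_ && ~~ _); apply: eq_existsb => k; rewrite !pq.
Qed.

(** The smallest dominator is direct: anything in between would be a smaller dominator. *)
Lemma exists_didominator n (p : 'I_n -> nat) i :
  [exists k, didominates p k i] = [exists k, dominates p k i].
Proof.
apply/existsP/existsP => [[k /andP[]] | [k ki]]; first by exists k.
case: (@arg_minnP _ k [pred k | dominates p k i] (@nat_of_ord n) ki) => m /= mi min; exists m.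
rewrite /didominates mi /=; apply/existsP => -[l /andP[ml li]].
by have := min _ li; move: ml; rewrite /dominates; lia.
Qed.

(** Dually, the largest dominated element is directly dominated. *)
Lemma exists_didominated n (p : 'I_n -> nat) i :
  [exists k, didominates p i k] = [exists k, dominates p i k].
Proof.
apply/existsP/existsP => [[k /andP[]] | [k ik]]; first by exists k.
case: (@arg_maxnP _ k [pred k | dominates p i k] (@nat_of_ord n) ik) => m /= im max; exists m.
rewrite /didominates im /=; apply/existsP => -[l /andP[il lm]].
by have := max _ il; move: lm; rewrite /dominates; lia.
Qed.

Lemma position_self_inverting n (pi : 'S_n) i :
  self_inverting pi -> position pi i = pi i.
Proof. by move=> inv; rewrite /position -{1}(inv i) permK. Qed.

Lemma D_edgeP n (pi : 'S_n) a (i : 'I_n) :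
  reflect ((exists2 k : 'I_n, a = k.+1 & didominates (position pi) k i) \/
           (a = n.+1 /\ ~~ [exists k, dominates (position pi) k i]))
          (D_edge pi a i.+1).
Proof.
rewrite /D_edge /st_graph /= orbF -exists_didominator.
apply: (iffP orP) => -[].
- case/existsP=> k /existsP[j /and3P[/eqP-> /eqP[/ord_inj->] kj]].
  by left; exists k.
- by case/andP=> /eqP-> /existsP[j /andP[/eqP[/ord_inj->] nj]]; right.
- case=> k -> ki; left; apply/existsP; exists k; apply/existsP; exists i.
  by rewrite !eqxx.
- by case=> -> ni; right; rewrite eqxx; apply/existsP; exists i; rewrite eqxx.
Qed.

Lemma max_inE n (pi : 'S_n) (i : 'I_n) m :
  D_edge pi m i.+1 -> (forall a, D_edge pi a i.+1 -> a <= m) -> max_in pi i = m.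
Proof.
move=> Dm max; apply/eqP; rewrite eqn_leq; apply/andP; split.
  exact/max/max_in_edge.
have mn : m < n.+2.
  by case/D_edgeP: Dm => [[k -> _] | [-> _]]; [have := ltn_ord k; lia | lia].
by rewrite /max_in (bigD1 (Ordinal mn)) //= leq_maxl.
Qed.

Lemma max_in_gt n (pi : 'S_n) (i : 'I_n) : i < max_in pi i.
Proof.
by case/D_edgeP: (max_in_edge pi i) => [[k -> /andP[/andP[]]] | [-> _]];
  have := ltn_ord i; lia.
Qed.

Lemma max_in_le n (pi : 'S_n) (i : 'I_n) : max_in pi i <= n.+1.
Proof.
case/D_edgeP: (max_in_edge pi i) => [[k -> _] | [-> _]] //.
by rewrite ltnS ltnW.
Qed.

(* Among the dominators of an element, the directly dominating ones increase in
   value with their position, so the largest is the rightmost dominator. *)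
Lemma max_in_last_dominator n (pi : 'S_n) (i k : 'I_n) :
  dominates (position pi) k i ->
  (forall l, dominates (position pi) l i -> position pi l <= position pi k) ->
  max_in pi i = k.+1.
Proof.
move=> ki last; apply: max_inE.
  apply/D_edgeP; left; exists k => //; rewrite /didominates ki /=.
  by apply/existsP => -[l /andP[/andP[_ kl] /last]]; lia.
move=> a /D_edgeP[[l -> /andP[li /existsP nl]] | [_ /existsP[]]]; last by exists k.
(* A didominator [l] larger than [k] stands to the left of [k] by [last], so [k] would lie between
   [l] and [i]. *)
rewrite ltnS leqNgt; apply/negP => kl; case: nl; exists k; rewrite ki andbT.
rewrite /dominates kl ltn_neqAle last // andbT.
by apply/eqP => /ord_inj/perm_inj lk; rewrite lk ltnn in kl.
Qed.

Lemma max_in_no_dominator n (pi : 'S_n) (i : 'I_n) :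
  ~~ [exists k, dominates (position pi) k i] -> max_in pi i = n.+1.
Proof.
move=> ni; apply: max_inE; first by apply/D_edgeP; right.
move=> a /D_edgeP[[k -> _] | [-> _]] //; by rewrite ltnS ltnW.
Qed.

(** * Nearest greater elements and the stack *)

Lemma input_ord n (pi : 'S_n) (i : 'I_n) : mem (input pi) i.+1 = (pi i).+1.
Proof. by rewrite /= valK. Qed.

Lemma input_out n (pi : 'S_n) a : n < a -> mem (input pi) a = 0.
Proof. by case: a => //= a na; rewrite insubN // -leqNgt. Qed.

Lemma input_le n (pi : 'S_n) a : mem (input pi) a <= n.
Proof. by case: a => //= a; case: insubP. Qed.

(** The strict left-to-right maxima of [w]. For a prefix read from its last element backwards, this
    is the stack of the nearest-greater-element algorithm. *)
Fixpoint stack (w : seq nat) : seq nat :=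
  if w is x :: w' then x :: [seq y <- stack w' | x < y] else [::].

Definition first_above (v : nat) (w : seq nat) : nat := head 0 [seq x <- w | v < x].

(** An element removed on pushing [x] is at most [x] and comes after it, so it is never the first
    one above any [v]. *)
Lemma first_above_stack v w : first_above v (stack w) = first_above v w.
Proof.
rewrite /first_above; elim: w => //= x w IH; case: ltnP => //= xv; rewrite -IH.
by rewrite -filter_predI; congr head; apply: eq_filter => y /=; lia.
Qed.

(* The elements in the first [q] positions, from right to left, then [n.+1]. *)
Fixpoint seen n (pi : 'S_n) (q : nat) : seq nat :=
  if q is p.+1 then mem (input pi) q :: seen pi p else [:: n.+1].

Lemma mem_stack_seen n (pi : 'S_n) q : q <= n -> n.+1 \in stack (seen pi q).
Proof.
elim: q => [|q IH] qn; first by rewrite /= inE.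
by cbn [seen stack]; rewrite inE mem_filter ltnS input_le IH ?orbT // ltnW.
Qed.

(** Induction on [q]: either the newest element is above [v], or the answer for the shorter prefix
    stands. Cells hold [(pi j).+1], so being above [v] reads [v <= pi j]. *)
Lemma first_above_seen n (pi : 'S_n) q v : q <= n -> v <= n ->
  (exists j : 'I_n, [/\ j < q, v <= pi j, first_above v (seen pi q) = (pi j).+1
     & forall l : 'I_n, l < q -> v <= pi l -> l <= j])
  \/ (first_above v (seen pi q) = n.+1 /\ forall l : 'I_n, l < q -> pi l < v).
Proof.
move=> + vn; elim: q => [|q IH] qn; first by right; rewrite /first_above /= ltnS vn.
rewrite /first_above; cbn [seen]; rewrite -[q]/(nat_of_ord (Ordinal qn)) input_ord.
set i := Ordinal qn; rewrite [filter _ _]/= ltnS; case: leqP => [vi | iv].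
  by left; exists i; split=> // l; rewrite ltnS.
have lS (l : 'I_n) : l < q.+1 -> v <= pi l -> l < q.
  rewrite ltnS leq_eqVlt => /orP[/eqP lq | //].
  by rewrite (_ : l = i) 1?leqNgt ?iv //; exact: val_inj.
case: (IH (ltnW qn)) => [[j [jq vj fj last]] | [f0 none]]; [left | right].
  by exists j; split=> // [|l lq vl]; [exact: ltnW | exact: last (lS _ lq vl) vl].
split=> // l lq; rewrite ltnNge; apply/negP => vl.
by have := none l (lS _ lq vl); rewrite ltnNge vl.
Qed.

(** The dominators of the element at position [k] are the greater elements to its left. If there are
    none, the search ends at [n.+1], which is the index of s. *)
Lemma first_above_max_in n (pi : 'S_n) (k : 'I_n) :
  first_above (pi k).+1 (seen pi k) = max_in pi (pi k).
Proof.
have domE (l : 'I_n) : dominates (position pi) (pi l) (pi k) = (pi k < pi l) && (l < k).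
  by rewrite /dominates /position !permK.
have [||[j [jk kj -> last]] | [-> none]] := @first_above_seen n pi k (pi k).+1.
- exact: ltnW.
- exact: ltn_ord.
- symmetry; apply: max_in_last_dominator => [|l]; first by rewrite domE kj.
  rewrite -(permKV pi l) domE /position !permK => /andP[kl lk]; exact: last.
- symmetry; apply: max_in_no_dominator; apply/existsP => -[l].
  rewrite -(permKV pi l) domE => /andP[kl /none]; lia.
Qed.

(** * Sinks and sources: building [D] *)

Lemma sinkE n (pi : 'S_n) i : self_inverting pi ->
  [exists k, didominates (position pi) i k] =
  [exists k : 'I_n, (k < i) && (pi i < pi k)].
Proof.
move=> inv; rewrite exists_didominated; apply: eq_existsb => k.
by rewrite /dominates !position_self_inverting.
Qed.

Lemma sourceE n (pi : 'S_n) i : self_inverting pi ->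
  [exists k, didominates (position pi) k i] =
  [exists k : 'I_n, (i < k) && (pi k < pi i)].
Proof.
move=> inv; rewrite exists_didominator; apply: eq_existsb => k.
by rewrite /dominates !position_self_inverting.
Qed.

Infix ";;" := Seq (at level 61, right associativity).

Ltac simpl_state := rewrite /set_reg /set_mem /upd /=.

(** Reads, tests and loops are excluded: they need facts about memory, a case split or an
    invariant. *)
Ltac step :=
  lazymatch goal with
  | |- wp _ (Seq _ _) _ _ _ => apply: wp_seq
  | |- wp _ (Const _ _) _ _ _ => apply: wp_const; [lia | lia |]
  | |- wp _ (Add _ _ _) _ _ _ => apply: wp_add; [lia | simpl_state; lia |]
  | |- wp _ (Sub _ _ _) _ _ _ => apply: wp_sub; [lia | simpl_state; lia |]
  | |- wp _ (Write _ _) _ _ _ =>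
      apply: wp_write; [lia | simpl_state; lia | simpl_state; lia |]
  end; simpl_state.

(* [pi] being its own inverse, cell i holds both the element at position i and
   the position of i.  So the elements are scanned by increasing value, and one is
   a sink when its position is at least the running maximum in register 9; sources
   are found dually. *)
Definition mark_sinks : prog :=
  Const 5 1 ;; Const 9 0 ;;
  WhileLt 5 6
    (Read 7 5 ;;
     IfLt 7 9 (Const 8 0) (Add 8 3 5 ;; Write 8 4 ;; Add 9 7 1) ;;
     Add 5 5 4).

Definition mark_sources : prog :=
  Add 5 0 1 ;; Add 9 6 1 ;; Const 10 0 ;;
  WhileLt 10 5
    (Read 7 5 ;;
     IfLt 9 7 (Const 8 0) (Add 8 2 5 ;; Write 8 4 ;; Add 9 7 1) ;;
     Sub 5 5 4).

Definition build_D : prog :=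
  Const 4 1 ;; Add 2 0 1 ;; Add 3 0 0 ;; Add 6 0 4 ;; mark_sinks ;; mark_sources.

(** The input serves as the position table, at base 0; source marks occupy cells n+1 to 2n and sink
    marks 2n+1 to 3n. As register 1 holds 0, adding it copies a register. *)
Definition phase1_regs n (s : state) : Prop :=
  [/\ reg s 0 = n, reg s 1 = 0, reg s 2 = n, reg s 3 = n + n & reg s 4 = 1 /\ reg s 6 = n.+1].

(** [K] is time reserved for what follows. An iteration takes at most 7 steps, so 10 per element
    also covers the set-up. *)
Lemma wp_mark_sinks B n (pi : 'S_n) K t s :
  10 * n.+1 <= B -> 10 * n.+1 + K <= t ->
  phase1_regs n s -> (forall a, mem s a = mem (input pi) a) ->
  wp B mark_sinks t s (fun t' s' =>
    [/\ K <= t', phase1_regs n s',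
        forall a, a <= n + n -> mem s' a = mem (input pi) a
      & forall i : 'I_n, (mem s' (n + n + i.+1) == 1) =
          ~~ [exists j : 'I_n, (j < i) && (pi i < pi j)]]).
Proof.
move=> leB let_ [s0 s1 s2 s3 [s4 s6]] ms.
rewrite /mark_sinks; step; step; step; step.
(* Register 9 is the maximum of the first [k] cells, described by the numbers below it. *)
pose I t s := exists k, [/\ k <= n, 10 * (n - k) + K < t,
  phase1_regs n s /\ [/\ reg s 5 = k.+1, reg s 9 <= n &
     forall v, (v < reg s 9) = [exists j : 'I_n, (j < k) && (v <= pi j)]],
  forall a, a <= n + n -> mem s a = mem (input pi) a &
  forall i : 'I_n, (mem s (n + n + i.+1) == 1) =
          (i < k) && ~~ [exists j : 'I_n, (j < i) && (pi i < pi j)]].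
apply: (wp_while (I := I)); last first.
  exists 0; split=> //=; [lia| |by move=> i; rewrite ms input_out //; lia].
  split=> //; split=> // v; symmetry; apply/existsP => -[]//.
move=> {s0 s1 s2 s3 s4 s6 ms let_ t s} t s.
move=> [k [kn let_ [[s0 s1 s2 s3 [s4 s6]] [s5 s9 max]] mA mT]].
split; first lia.
rewrite s5 s6 ltnS; case: ltnP => [{}kn | nk]; last first.
  have kE : k = n by lia.
  by split=> // [|i]; [lia | rewrite mT kE ltn_ord].
set o := Ordinal kn; have mk : mem s k.+1 = (pi o).+1.
  by rewrite mA -?(input_ord pi o) //=; lia.
have pin := ltn_ord (pi o).
step; apply: wp_read; [lia | lia | rewrite s5 mk; lia |].
rewrite s5 mk; simpl_state; step.
(* At this value the invariant says exactly that the test fails if and only if [o] is a sink. *)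
have maxo := max (pi o).+1.
apply: wp_if; simpl_state; [lia | |] => cmp.
  step; step.
  exists k.+1; split; [lia | lia | | by [] |].
    split=> //; rewrite s4 s5 addn1; split=> // v.
    rewrite (exists_ltS kn) -max -/o /=; lia.
  move=> i; simpl_state; rewrite mT ltnS (leq_eqVlt i).
  case: eqP => //= ik; rewrite ik ltnn /=.
  by rewrite (_ : i = o) -?maxo ?cmp //; exact: val_inj.
step; step; step; step; step; step.
exists k.+1; rewrite s3 s4 s5 s1; split; [lia | lia | | |].
- split=> //; rewrite ?addn1 addn0; split=> // v.
  rewrite (exists_ltS kn) -max -/o /=; lia.
- by move=> a an; simpl_state; case: eqP => [|_]; [lia | exact: mA].
move=> i; simpl_state; rewrite eqn_add2l eqSS; case: (i =P k :> nat) => ik.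
  rewrite ik ltnSn (_ : i = o); last exact: val_inj.
  by rewrite -maxo -leqNgt cmp.
by rewrite mT; congr (_ && _); lia.
Qed.

Lemma wp_mark_sources B n (pi : 'S_n) K t s :
  10 * n.+1 <= B -> 10 * n.+1 + K <= t -> phase1_regs n s ->
  (forall a, a <= n + n -> mem s a = mem (input pi) a) ->
  wp B mark_sources t s (fun t' s' =>
    [/\ K <= t', phase1_regs n s',
        forall a, a <= n -> mem s' a = mem (input pi) a,
        forall a, n + n < a -> mem s' a = mem s a
      & forall i : 'I_n, (mem s' (n + i.+1) == 1) =
          ~~ [exists j : 'I_n, (i < j) && (pi j < pi i)]]).
Proof.
move=> leB let_ [s0 s1 s2 s3 [s4 s6]] ms.
rewrite /mark_sources; step; step; step; step; step; step.
(* The dual invariant, for the minimum over a suffix. The restriction to [v <= n] is there because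
   the empty suffix has the finite minimum [n.+1]. *)
pose I t s' := exists k, [/\ k <= n, 10 * k + K < t,
  phase1_regs n s' /\ [/\ reg s' 5 = k, reg s' 10 = 0, reg s' 9 <= n.+1 &
     forall v, v <= n ->
       (reg s' 9 < v) = [exists j : 'I_n, (k <= j) && ((pi j).+1 < v)]],
  (forall a, a <= n -> mem s' a = mem (input pi) a) /\
  (forall a, n + n < a -> mem s' a = mem s a) &
  forall i : 'I_n, (mem s' (n + i.+1) == 1) =
          (k <= i) && ~~ [exists j : 'I_n, (i < j) && (pi j < pi i)]].
apply: (wp_while (I := I)); last first.
  exists n; split=> //=; [lia| | |move=> i].
  - split=> //; rewrite s0 s1 s6 !addn0; split=> // v vn; rewrite ltnNge ltnW //=.
    by symmetry; apply/existsP => -[j]; rewrite leqNgt ltn_ord.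
  - by split=> // a an; apply: ms; lia.
  - have lin := ltn_ord i; rewrite [n <= i]leqNgt lin ms; last lia.
    by rewrite input_out //; lia.
move=> {s0 s1 s2 s3 s4 s6 let_ t} t s'.
move=> [k [kn let_ [[s0 s1 s2 s3 [s4 s6]] [s5 s10 s9 min]] [mA mT] mS]].
split; first lia.
rewrite s5 s10; case: k => [|k] in kn let_ s5 min mS *.
  by split=> //; lia.
rewrite ltn0Sn.
set o := Ordinal kn; have mk : mem s' k.+1 = (pi o).+1.
  by rewrite mA -?(input_ord pi o) //=; lia.
have pin := ltn_ord (pi o).
step; apply: wp_read; [lia | lia | rewrite s5 mk; lia |].
rewrite s5 mk; simpl_state; step.
have mino := min _ pin.
apply: wp_if; simpl_state; [lia | |] => cmp.
  step; step.
  exists k; split; [lia | lia | | by [] |].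
    split=> //; rewrite s4 s5 subn1; split=> // v vn.
    rewrite (exists_leS kn) -min // -/o /=; lia.
  move=> i; simpl_state; rewrite mS (leq_eqVlt k).
  case: (k =P i :> nat) => //= ik; rewrite -ik ltnn /=.
  by rewrite (_ : i = o) -?mino ?cmp //; exact: val_inj.
step; step; step; step; step; step.
exists k; rewrite s2 s4 s5 s1; split; [lia | lia | | |].
- split=> //; rewrite ?subn1 addn0; split=> //= [|v vn]; first lia.
  rewrite (exists_leS kn) -min // -/o /=; lia.
- split=> a an; simpl_state; (case: eqP => [|_]; first lia); [exact: mA|exact: mT].
move=> i; simpl_state; rewrite eqn_add2l eqSS; case: (i =P k :> nat) => ik.
  rewrite ik leqnn (_ : i = o); last exact: val_inj.
  by rewrite -mino -leqNgt cmp.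
by rewrite mS; congr (_ && _); lia.
Qed.

Lemma wp_build_D B n (pi : 'S_n) K : self_inverting pi ->
  10 * n.+1 <= B ->
  wp B build_D (30 * n.+1 + K) (input pi) (fun t s =>
    [/\ K <= t, phase1_regs n s, forall a, a <= n -> mem s a = mem (input pi) a
      & stores_D s pi]).
Proof.
move=> inv leB; rewrite /build_D; do 8 step; step.
apply: (wp_mono (wp_mark_sinks (pi := pi) (K := 10 * n.+1 + K) leB _ _ _)) => //=.
- lia.
- by split=> //; rewrite ?addn0 ?addn1.
move=> t1 s1 [let1 regs1 mA mT].
apply: (wp_mono (wp_mark_sources leB let1 regs1 mA)) => t2 s2.
case=> let2 regs2 {}mA mK mS; split=> //.
case: regs2 => s2_0 s2_1 s2_2 s2_3 _.
(* The untouched input cells give the positions, [pi] being its own inverse. *)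
have eP : didominates (entry s2 1 (n := n)) =2 didominates (position pi).
  apply: didominates_ltn_mono => i j.
  by rewrite /entry s2_1 !add0n !mA ?ltn_ord // !input_ord ltnS !position_self_inverting.
move=> a b; rewrite /D_edge /st_graph; congr [|| _, _ && _ | _ && _].
- by apply: eq_existsb => i; apply: eq_existsb => j; rewrite eP.
- apply: eq_existsb => i; congr (_ && _).
  by rewrite /entry s2_2 mS sourceE.
- apply: eq_existsb => i; congr (_ && _).
  by rewrite /entry s2_3 mK ?mT ?sinkE //; lia.
Qed.

(** * The stack algorithm for [p] *)

(** Keeps the addresses reached by following pointers within the memory bound. *)
Lemma mem_stack_le n (pi : 'S_n) q : all (leq^~ n.+1) (stack (seen pi q)).
Proof.
elim: q => [|q IH]; first by rewrite /= leqnn.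
cbn [seen stack]; apply/allP => x; rewrite inE mem_filter.
by case/orP=> [/eqP-> | /andP[_ /(allP IH)] //]; rewrite leqW ?input_le.
Qed.

(* The p-pointers already written double as the stack of candidates: from the
   previous element (register 9), follow them until the current element
   (register 7) is exceeded. *)
Definition compute_p : prog :=
  Add 1 3 0 ;; Const 5 1 ;; Add 9 0 4 ;;
  WhileLt 5 6
    (Read 7 5 ;; Add 10 7 4 ;;
     WhileLt 9 10 (Add 8 1 9 ;; Read 9 8) ;;
     Add 8 1 7 ;; Write 8 9 ;; Sub 9 10 4 ;; Add 5 5 4).

Definition phase2_regs n (s : state) : Prop :=
  [/\ reg s 0 = n, reg s 1 = n + n + n, reg s 4 = 1 & reg s 6 = n.+1].

(** The stack is a linked list threaded through the table of [p]; [x < y] records that it increases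
    from its top downwards. *)
Definition linked n (s : state) : rel nat :=
  fun x y => (x < y) && (mem s (n + n + n + x) == y).

Lemma wp_compute_p B n (pi : 'S_n) K t s :
  10 * n.+1 <= B -> 20 * n.+1 + K <= t -> phase1_regs n s ->
  (forall a, a <= n -> mem s a = mem (input pi) a) ->
  wp B compute_p t s (fun t' s' =>
    [/\ K <= t', phase2_regs n s' & stores_p s' pi]).
Proof.
move=> leB let_ [s0 s1 s2 s3 [s4 s6]] ms.
rewrite /compute_p; step; step; step; step; step; step.
(* Every pop is paid for by a push: the stack size is the potential. *)
pose I t s := exists k rest, [/\ k <= n /\ reg s 5 = k.+1,
  3 * size rest + 12 * (n - k) + K < t, phase2_regs n s,
  stack (seen pi k) = reg s 9 :: rest /\ path (linked n s) (reg s 9) rest &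
  (forall a, a <= n -> mem s a = mem (input pi) a) /\
  forall i : 'I_n, i < k -> mem s (n + n + n + (pi i).+1) = max_in pi (pi i)].
apply: (wp_while (I := I)); last first.
  exists 0, [::]; rewrite s0 s3 s4 addn1; split=> //=; lia.
move=> {s0 s1 s2 s3 s4 s6 ms let_ t s} t s.
move=> [k [rest [[kn s5] let_ [s0 s1 s4 s6] [stackE links] [mA mP]]]].
split; first lia.
rewrite s5 s6 ltnS; case: ltnP => [{}kn | nk]; last first.
  have kE : k = n by lia.
  split=> // [|i]; first lia.
  by rewrite /entry s1 -{1}(permKV pi i) mP ?permKV // kE.
set o := Ordinal kn; have mk : mem s k.+1 = (pi o).+1.
  by rewrite mA -?(input_ord pi o).
have pin := ltn_ord (pi o); set v := (pi o).+1 in mk.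
step; apply: wp_read; [lia | lia | rewrite s5 mk; lia |].
rewrite s5 mk; simpl_state; step; step; step.
(* Popping removes only elements at most [v], so the part above [v] is invariant. The [+ 3] is the
   outer test, the read and the addition already paid; each pop costs 3. *)
pose J t s' := exists rest',
  [/\ 3 * size rest' + 12 * (n - k) + K < t + 3,
   [/\ phase2_regs n s', reg s' 5 = k.+1, reg s' 7 = v & reg s' 10 = v.+1],
   mem s' = mem s,
   [/\ path (linked n s) (reg s' 9) rest', all (leq^~ n.+1) (reg s' 9 :: rest')
     & n.+1 \in reg s' 9 :: rest'] &
   [seq x <- reg s' 9 :: rest' | v < x] = [seq x <- stack (seen pi k) | v < x]].
apply: (wp_while (I := J)); last first.
  exists rest; split=> //=; first lia.
  - by rewrite s4 addn1.
  - by have := mem_stack_le pi k; have := @mem_stack_seen n pi k (ltnW kn); rewrite stackE.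
  - by rewrite stackE.
move=> {let_ t} t s' [rest' [let_ [[s'0 s'1 s'4 s'6] s'5 s'7 s'10] ms' [lk le_ top] flt]].
split; first lia.
rewrite s'10 ltnS; case: leqP => [ev | ve].
  (* The stack cannot run out: [n.+1] is still on it and exceeds [v]. *)
  case: rest' => [|x rest'] in let_ lk le_ top flt *.
    by move: top; rewrite inE; lia.
  case/andP: lk => /andP[ex /eqP mx] lk; case/and3P: le_ => e1 x1 le_.
  have mx' : mem s' (reg s' 1 + reg s' 9) = x by rewrite ms' s'1.
  step; step; apply: wp_read; simpl_state; [lia | lia | lia |].
  rewrite mx'; exists rest'; split=> //=; rewrite ?x1 //.
  - by move: let_ => /=; lia.
  - by split=> //; move: top; rewrite inE => /orP[|//]; lia.
  - by rewrite -flt /= [v < reg s' 9]ltnNge ev.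
case/andP: le_ => e1 le_.
(* As the stack increases, everything left exceeds [v] once its top does; register 9 is then the
   nearest greater element. *)
have above : all (ltn v) (reg s' 9 :: rest').
  have incr : path ltn (reg s' 9) rest' by move: lk; apply: sub_path => x y /andP[].
  rewrite /= ve; apply: sub_all (order_path_min ltn_trans incr) => x.
  exact: ltn_trans.
step; step; step; step; step; step; step.
rewrite s'7 s'10 s'4 s'5 s'1 subn1 addn1.
rewrite (all_filterP above) in flt.
have maxE : max_in pi (pi o) = reg s' 9.
  by rewrite -first_above_max_in -first_above_stack /first_above -flt.
exists k.+1, (reg s' 9 :: rest'); split=> //; first by move=> /=; lia.
- split.
    by cbn [seen stack]; rewrite (input_ord pi o : mem (input pi) k.+1 = v) -flt.
  rewrite /= /linked /= ve !eqxx /=.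
  (* The write changes only the link of [v], and all older links kept start above [v]. *)
  move: lk; apply: (sub_in_path (P := ltn v)) => // x y vx _ /= /andP[-> /eqP <-].
  by rewrite eqn_add2l ms' (gtn_eqF (vx : v < x)) eqxx.
- split=> [a an | i]; simpl_state.
    by rewrite ms'; case: eqP => [|_]; [lia | exact: mA].
  rewrite eqn_add2l ltnS leq_eqVlt => /orP[/eqP ik | ik].
    by rewrite (_ : i = o) ?eqxx ?maxE //; exact: val_inj.
  rewrite eqSS (inj_eq (@ord_inj n)) (inj_eq perm_inj) -val_eqE ltn_eqF //.
  by rewrite ms' mP.
Qed.

(** * Writing the edges of [F] *)

Definition write_list_pointers : prog :=
  Const 5 0 ;;
  WhileLt 5 6
    (Add 9 5 4 ;; Write 8 9 ;; Add 8 8 4 ;; Write 8 5 ;; Add 8 8 4 ;; Add 5 5 4).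

Definition write_max_pointers : prog :=
  Const 5 1 ;;
  WhileLt 5 6
    (Write 8 5 ;; Add 8 8 4 ;; Add 7 1 5 ;; Read 7 7 ;; Write 8 7 ;; Add 8 8 4 ;;
     Add 5 5 4).

Definition add_edges : prog :=
  Const 10 0 ;; Add 2 1 6 ;; Add 8 2 10 ;;
  write_list_pointers ;; write_max_pointers ;;
  Add 1 2 10 ;; Add 2 0 6.

(** The first cell after the table of [p], which fills 3n+1 to 4n. The 2n+1 edges then end at cell
    8n+2, within the bound 10(n+1). *)
Definition edge_base n : nat := n + n + n + n.+1.

(** [k] edges are written and register 8 points to the next free cell. Register 1 stays the base of
    [p] until all edges are written. *)
Definition phase3_regs n k (s : state) : Prop :=
  [/\ phase2_regs n s, reg s 2 = edge_base n, reg s 10 = 0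
    & reg s 8 = edge_base n + k.*2].

Definition edge_at n (s : state) k (e : nat * nat) : Prop :=
  mem s (edge_base n + k.*2) = e.1 /\ mem s (edge_base n + k.*2.+1) = e.2.

Lemma wp_write_list_pointers B n (pi : 'S_n) K t s :
  10 * n.+1 <= B -> 10 * n.+1 + K <= t ->
  phase3_regs n 0 s -> stores_p s pi ->
  wp B write_list_pointers t s (fun t' s' =>
    [/\ K <= t', phase3_regs n n.+1 s', stores_p s' pi
      & forall j, j < n.+1 -> edge_at n s' j (j.+1, j)]).
Proof.
move=> leB let_ [[s0 s1 s4 s6] s2 s10 s8] sp.
rewrite /write_list_pointers; step; step.
pose I t s := exists k, [/\ k <= n.+1 /\ reg s 5 = k, 7 * (n.+1 - k) + K < t,
  phase3_regs n k s, stores_p s pi & forall j, j < k -> edge_at n s j (j.+1, j)].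
apply: (wp_while (I := I)); last by exists 0; split=> //=; lia.
move=> {s0 s1 s2 s4 s6 s8 s10 sp let_ t s} t s.
move=> [k [[kn s5] let_ [[s0 s1 s4 s6] s2 s10 s8] sp es]].
split; first lia.
rewrite s5 s6; case: ltnP => [{}kn | nk]; last first.
  have kE : k = n.+1 by lia.
  by move: es s8; rewrite kE => es s8; split=> //; lia.
rewrite /edge_base in s8 s2 *.
step; step; step; step; step; step; step; step; step; step; step.
exists k.+1; split=> //=; first by lia.
- by lia.
- by split; rewrite ?s2 ?s10 /edge_base //=; lia.
- move=> i; rewrite /entry /=; have := ltn_ord i; have := sp i; rewrite /entry.
  case: eqP => [|_]; first by lia. case: eqP => [|_]; first by lia. by [].
move=> j; rewrite ltnS leq_eqVlt /edge_at /= s8 s5 s4 /edge_base => /orP[/eqP -> | jk].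
  split; do ?[case: eqP => //]; lia.
have [e1 e2] := es j jk; rewrite /edge_base in e1 e2.
split; do ?[case: eqP => //]; lia.
Qed.

Lemma wp_write_max_pointers B n (pi : 'S_n) K t s :
  10 * n.+1 <= B -> 10 * n.+1 + K <= t ->
  phase3_regs n n.+1 s -> stores_p s pi ->
  (forall j, j < n.+1 -> edge_at n s j (j.+1, j)) ->
  wp B write_max_pointers t s (fun t' s' =>
    [/\ K <= t', phase3_regs n (n.+1 + n) s',
        forall j, j < n.+1 -> edge_at n s' j (j.+1, j)
      & forall i : 'I_n, edge_at n s' (n.+1 + i) (i.+1, max_in pi i)]).
Proof.
move=> leB let_ [[s0 s1 s4 s6] s2 s10 s8] sp es.
rewrite /write_max_pointers; step; step.
pose I t s := exists k, [/\ k <= n /\ reg s 5 = k.+1, 8 * (n - k) + K < t,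
  phase3_regs n (n.+1 + k) s /\ stores_p s pi,
  forall j, j < n.+1 -> edge_at n s j (j.+1, j) &
  forall i : 'I_n, i < k -> edge_at n s (n.+1 + i) (i.+1, max_in pi i)].
apply: (wp_while (I := I)); last first.
  by exists 0; rewrite addn0; split=> //=; lia.
move=> {s0 s1 s2 s4 s6 s8 s10 sp es let_ t s} t s.
move=> [k [[kn s5] let_ [[[s0 s1 s4 s6] s2 s10 s8] sp] es ms]].
split; first lia.
rewrite s5 s6 ltnS; case: ltnP => [{}kn | nk]; last first.
  have kE : k = n by lia.
  by move: ms s8; rewrite kE => ms s8; split=> //; [lia | move=> i; exact: ms].
set o := Ordinal kn; have := sp o; rewrite /entry s1 /= => mo.
have := max_in_le pi o => mole.
rewrite /edge_base in s8 s2 *.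
step; step; step; step; step; step; step.
(* The endpoint just written lies beyond the table of [p], so the entry is intact. *)
have mo' : mem (set_mem s (reg s 8) (reg s 5)) (reg s 1 + reg s 5) = max_in pi o.
  by rewrite /= /upd s1 s5 s8 mo; case: eqP => //; lia.
rewrite /set_mem /upd /= in mo'.
apply: wp_read; simpl_state; [lia | lia | rewrite mo'; lia |].
rewrite mo'; step; step; step; step; step.
exists k.+1; split=> //=; first by lia.
- by lia.
- split; first by split; rewrite ?s2 ?s10 /edge_base //=; lia.
  move=> i; rewrite /entry /=; have := ltn_ord i; have := sp i; rewrite /entry.
  case: eqP => [|_]; first by lia. case: eqP => [|_]; first by lia. by [].
- move=> j jn; have [e1 e2] := es j jn; rewrite /edge_at /edge_base in e1 e2 *.
  rewrite /= s8 s5 s4; split; do ?[case: eqP => //]; lia.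
move=> i; rewrite ltnS leq_eqVlt /edge_at /= s8 s5 s4 /edge_base => /orP[/eqP ik | ik].
  rewrite (_ : i = o); last exact: val_inj.
  split; do ?[case: eqP => //=]; lia.
have [e1 e2] := ms i ik; rewrite /edge_base in e1 e2.
split; do ?[case: eqP => //]; lia.
Qed.

Lemma edge_array_eq n (pi : 'S_n) s :
  reg s 1 = edge_base n -> reg s 2 = n.+1 + n ->
  (forall j, j < n.+1 -> edge_at n s j (j.+1, j)) ->
  (forall i : 'I_n, edge_at n s (n.+1 + i) (i.+1, max_in pi i)) ->
  edge_array s = [seq (j.+1, j) | j <- iota 0 n.+1] ++
                 [seq ((nat_of_ord i).+1, max_in pi i) | i <- enum 'I_n].
Proof.
move=> s1 s2 es ms; rewrite /edge_array s1 s2 iotaD map_cat add0n; congr (_ ++ _).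
  apply/eq_in_map => j; rewrite mem_iota => /es[/= -> ->] //.
rewrite -[in iota _ _](addn0 n.+1) iotaDl -val_enum_ord -!map_comp.
by apply: eq_map => i /=; have [/= -> ->] := ms i.
Qed.

Lemma stores_F_edges n (pi : 'S_n) s :
  edge_array s = [seq (j.+1, j) | j <- iota 0 n.+1] ++
                 [seq ((nat_of_ord i).+1, max_in pi i) | i <- enum 'I_n] ->
  stores_F s pi.
Proof.
move=> sE; rewrite /stores_F sE; split=> [|a b].
  have inj1 : injective (fun j => (j.+1, j)) by move=> i j [].
  have inj2 : injective (fun i : 'I_n => ((nat_of_ord i).+1, max_in pi i)).
    by move=> i j [/ord_inj].
  rewrite cat_uniq (map_inj_uniq inj1) (map_inj_uniq inj2) iota_uniq enum_uniq andbT.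
  (* List pointers descend and max-didomination pointers ascend, so no edge is of both kinds. *)
  apply/hasPn => _ /mapP[i _ ->]; apply/mapP => -[j _ [<-]].
  by have := max_in_gt pi i; lia.
rewrite mem_cat /F_edge; congr (_ || _).
  apply/mapP/andP => [[j] | [bn /eqP->]]; last by exists b; rewrite // mem_iota.
  by rewrite mem_iota => jn [-> ->]; rewrite eqxx.
apply/mapP/existsP => [[i _ [-> ->]] | [i /andP[/eqP-> /eqP->]]]; exists i; rewrite ?eqxx //.
by rewrite mem_enum.
Qed.

Lemma wp_add_edges B n (pi : 'S_n) t s :
  10 * n.+1 <= B -> 30 * n.+1 <= t -> phase2_regs n s -> stores_p s pi ->
  wp B add_edges t s (fun t' s' => stores_F s' pi).
Proof.
move=> leB let_ [s0 s1 s4 s6] sp.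
rewrite /add_edges; step; step; step; step; step; step; step.
(* The reserve pays for the second loop and the two final additions. *)
apply: (wp_mono (wp_write_list_pointers (K := 10 * n.+1 + 2) (pi := pi) leB _ _ _)).
- by lia.
- by rewrite /phase3_regs /edge_base /= s1 s6 !addn0.
- by move=> i; have := sp i; rewrite /entry.
move=> t1 s1' [let1 regs1 sp1 es1]; step.
apply: (wp_mono (wp_write_max_pointers (K := 2) leB let1 regs1 sp1 es1)).
move=> t2 s2' [let2 [[s2'0 s2'1 s2'4 s2'6] s2'2 s2'10 s2'8] es2 ms2].
rewrite /edge_base in s2'2; step; step; step.
apply/stores_F_edges/edge_array_eq => //=; rewrite ?s2'10 ?s2'2 ?s2'0 ?s2'6 /edge_base; lia.
Qed.

(** * Linear time and space *)

Theorem theorem3 :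
  exists (build_D compute_p add_edges : prog) (c : nat),
  forall (n : nat) (pi : 'S_n), self_inverting pi ->
    Encode_SIP_to_RPG build_D compute_p add_edges (c * n.+1) (c * n.+1) pi.
Proof.
(* The time budgets of the three phases are 30, 20 and 30 times n+1; memory needs only 10 times
   n+1. *)
exists build_D, compute_p, add_edges, 80 => n pi inv.
have leB : 10 * n.+1 <= 80 * n.+1 by lia.
have [T1 [t1 [s1 [r1 le1 [let1 regs1 mA sD]]]]] :=
  wp_build_D (50 * n.+1) inv leB.
have let1' : 20 * n.+1 + 30 * n.+1 <= t1 by lia.
have [T2 [t2 [s2 [r2 le2 [let2 regs2 sp]]]]] :=
  wp_compute_p leB let1' regs1 mA.
have [T3 [t3 [s3 [r3 le3 sF]]]] := wp_add_edges leB let2 regs2 sp.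
exists s1, s2, s3, T1, T2, T3; split=> //; lia.
Qed.
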